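(* Let $X$ be a finite normal Cayley graph and let $Y$ be a core of $X$. Then there exists a partition $\{V_1,\ldots,V_k\}$ of $V(X)$ such that, for each $i$, the subgraph of $X$ induced by $V_i$ is isomorphic to $Y$.
   Context: All graphs are finite, undirected and simple (no loops). A homomorphism from a graph $X$ to a graph $Y$ is a map $\varphi:V(X)\to V(Y)$ such that $\varphi(x)$ is adjacent to $\varphi(y)$ whenever $x$ is adjacent to $y$. A core of a graph $X$ is a subgraph of $X$ with the minimum number of vertices among all subgraphs to which $X$ admits a homomorphism (all cores of $X$ are isomorphic). For a finite group $G$ and an inverse-closed subset $C\subseteq G\setminus\{1\}$, the Cayley graph $X(G,C)$ is the graph with vertex set $G$ in which $g$ and $h$ are adjacent if $g^{-1}h\in C$. The Cayley graph $X(G,C)$ is called normal if $g^{-1}Cg=C$ for all $g\in G$. *)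

(* Defs.v *)
From mathcomp Require Import all_boot all_fingroup.

Set Implicit Arguments.
Unset Strict Implicit.
Unset Printing Implicit Defensive.

Import GroupScope.

Record sgraph := SGraph {
  vertex :> finType;
  adj : rel vertex;
  adj_sym : symmetric adj;
  adj_irr : irreflexive adj }.

Definition homomorphism (X Y : sgraph) (f : X -> Y) : Prop :=
  forall x y : X, adj x y -> adj (f x) (f y).

Definition admits_hom (X Y : sgraph) : Prop :=
  exists f : X -> Y, homomorphism f.

Definition isomorphic (X Y : sgraph) : Prop :=
  exists2 f : X -> Y, bijective f & forall x y : X, adj (f x) (f y) = adj x y.

(* Subgraphs need not be induced: the edges are any symmetric subrelation of
   [adj] between vertices of the subgraph. *)
Record subgraph (X : sgraph) := Subgraph {
  sub_vertices : {set X};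
  sub_adj : rel X;
  sub_adj_sym : symmetric sub_adj;
  sub_adj_vertex : forall x y, sub_adj x y -> x \in sub_vertices;
  sub_adj_adj : forall x y, sub_adj x y -> adj x y }.

Section SubgraphGraph.
Variables (X : sgraph) (Y : subgraph X).

Definition sub_vertex := {x : X | x \in sub_vertices Y}.
Definition sub_rel : rel sub_vertex := fun x y => sub_adj Y (val x) (val y).

Fact sub_rel_sym : symmetric sub_rel.
Proof. by move=> x y; apply: sub_adj_sym. Qed.

Fact sub_rel_irr : irreflexive sub_rel.
Proof. by move=> x; apply/negP => /sub_adj_adj; rewrite adj_irr. Qed.

Definition sgraph_of_subgraph : sgraph := SGraph sub_rel_sym sub_rel_irr.
End SubgraphGraph.

Coercion sgraph_of_subgraph : subgraph >-> sgraph.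

Section Induced.
Variables (X : sgraph) (V : {set X}).

Definition induced_rel : rel X := fun x y => [&& x \in V, y \in V & adj x y].

Fact induced_rel_sym : symmetric induced_rel.
Proof. by move=> x y; rewrite /induced_rel adj_sym andbCA. Qed.

Fact induced_rel_vertex x y : induced_rel x y -> x \in V.
Proof. by case/and3P. Qed.

Fact induced_rel_adj x y : induced_rel x y -> adj x y.
Proof. by case/and3P. Qed.

Definition induced : subgraph X :=
  Subgraph induced_rel_sym induced_rel_vertex induced_rel_adj.
End Induced.

Definition is_core (X : sgraph) (Y : subgraph X) : Prop :=
  admits_hom X Y /\
  forall Z : subgraph X, admits_hom X Z ->
    #|sub_vertices Y| <= #|sub_vertices Z|.

Definition inverse_closed (gT : finGroupType) (C : {set gT}) : Prop :=
  forall g : gT, g \in C -> g^-1 \in C.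

Section Cayley.
Variables (gT : finGroupType) (C : {set gT}).
Hypotheses (C1 : 1 \notin C) (CV : inverse_closed C).

Definition cayley_rel : rel gT := fun g h => g^-1 * h \in C.

Fact cayley_rel_sym : symmetric cayley_rel.
Proof.
have H g h : cayley_rel g h -> cayley_rel h g.
  by move/CV; rewrite invMg invgK.
by move=> g h; apply/idP/idP; apply: H.
Qed.

Fact cayley_rel_irr : irreflexive cayley_rel.
Proof. by move=> g; rewrite /cayley_rel mulVg; apply: negbTE. Qed.

Definition cayley_graph : sgraph := SGraph cayley_rel_sym cayley_rel_irr.
End Cayley.

Definition conj_invariant (gT : finGroupType) (C : {set gT}) : Prop :=
  forall g : gT, C :^ g = C.

(* Main.v *)
Require Import Defs.
From mathcomp Require Import all_boot all_fingroup.

(** Let [S] be the vertex set of the core [Y] and [r] a homomorphism from the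
    ambient graph to [Y].  Minimality of the core makes every endomorphism of the
    ambient graph followed by [r] a bijection from [S] to [S]
    ([core_hom_inj], [core_hom_onto]); this applies in particular to the left
    translation by any group element [a], so each translate [a * S] meets the
    fibre [F] of [r] over a chosen vertex of [S] in exactly one point [c a].
    As [a] belongs to [c * S^-1] exactly when [c] belongs to [a * S], the sets
    [c * S^-1] with [c] in [F] partition the group: they are the classes of
    the map sending [a] to [c a].

    It remains to see that [c * S^-1] induces a copy of [Y].  Normality enters
    here: inversion is an automorphism of a normal Cayley graph
    ([cayley_rel_inv]), as left translations are in any Cayley graph, so
    [c * S^-1] and [S] induce isomorphic subgraphs.  Finally [S] induces [Y]
    itself, since a core contains all the edges between its vertices
    ([core_adj]). *)

Set Implicit Arguments.
Unset Strict Implicit.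
Unset Printing Implicit Defensive.

Import GroupScope.

Section Core.
Variables (X : sgraph) (Y : subgraph X).
Hypothesis coreY : is_core Y.
Let S := sub_vertices Y.

Lemma endo_image_hom (f : X -> X) :
  homomorphism f -> admits_hom X (induced (f @: [set: X])).
Proof.
move=> hf; have fim x : f x \in f @: [set: X] by rewrite imset_f.
exists (fun x => Sub (f x) (fim x)) => x y xy.
by rewrite /= /sub_rel /= /induced_rel !fim hf.
Qed.

Lemma core_card_endo (f : X -> X) :
  homomorphism f -> #|S| <= #|f @: [set: X]|.
Proof. by move/endo_image_hom/(proj2 coreY). Qed.

Variables (r : X -> Y) (a : X -> X).
Hypotheses (hr : homomorphism r) (ha : homomorphism a).

(** The endomorphism [r \o a \o r] takes all its values in the image of [S]
    under [r \o a], so that image has at least [#|S|] elements. *)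
Lemma core_hom_inj : {in S &, injective (fun x => val (r (a x)))}.
Proof.
apply/imset_injP; rewrite eqn_leq leq_imset_card /=.
have hom : homomorphism (fun x => val (r (a (val (r x))))).
  move=> x y xy; apply: sub_adj_adj; apply: hr; apply: ha.
  by apply: sub_adj_adj; apply: hr xy.
apply: leq_trans (core_card_endo hom) (subset_leq_card _).
apply/subsetP=> _ /imsetP[x _ ->].
exact: (imset_f (fun z => val (r (a z))) (valP (r x))).
Qed.

Lemma core_hom_onto : [set val (r (a x)) | x in S] = S.
Proof.
apply/eqP; rewrite eqEcard card_in_imset ?leqnn ?andbT; last exact: core_hom_inj.
by apply/subsetP=> _ /imsetP[x _ ->]; apply: valP.
Qed.

End Core.

(** A homomorphism to the core is injective on the core's vertices, so it maps
    the edges of the ambient graph between those vertices injectively to edges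
    of the core; counting shows that the core misses none of them. *)
Lemma core_adj (X : sgraph) (Y : subgraph X) :
  is_core Y -> {in sub_vertices Y &, sub_adj Y =2 adj (s := X)}.
Proof.
move=> coreY; have [[r hr] _] := coreY.
have rI := core_hom_inj coreY hr (a := id) (fun _ _ => id).
pose EX := [set p : X * X | [&& p.1 \in sub_vertices Y, p.2 \in sub_vertices Y
                              & adj p.1 p.2]].
pose EY := [set p : X * X | sub_adj Y p.1 p.2].
have memY x y : sub_adj Y x y -> (x \in sub_vertices Y) && (y \in sub_vertices Y).
  by move=> xy; rewrite (sub_adj_vertex xy) (@sub_adj_vertex _ Y y x) // sub_adj_sym.
have EYX : EY = EX.
  apply/eqP; rewrite eqEcard; apply/andP; split.
    apply/subsetP=> -[x y]; rewrite !inE /= => xy.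
    by rewrite (sub_adj_adj xy) andbT memY.
  pose rr (p : X * X) := (val (r p.1), val (r p.2)).
  rewrite -(@card_in_imset _ _ rr EX); last first.
    move=> [x y] [x' y']; rewrite !inE /= => /and3P[Sx Sy _] /and3P[Sx' Sy' _].
    by case=> /(rI _ _ Sx Sx') -> /(rI _ _ Sy Sy') ->.
  apply/subset_leq_card/subsetP=> _ /imsetP[[x y] + ->].
  by rewrite !inE /= => /and3P[_ _ /hr].
move=> x y Sx Sy; have /setP/(_ (x, y)) := EYX.
by rewrite !inE /= Sx Sy.
Qed.

Section NormalCayley.
Variables (gT : finGroupType) (C : {set gT}).

Lemma cayley_rel_mull (a g h : gT) :
  cayley_rel C (a * g) (a * h) = cayley_rel C g h.
Proof. by rewrite /cayley_rel invMg -mulgA mulKg. Qed.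

Hypotheses (CV : inverse_closed C) (CJ : conj_invariant C).

Lemma cayley_rel_mulr (a g h : gT) :
  cayley_rel C (g * a) (h * a) = cayley_rel C g h.
Proof.
rewrite /cayley_rel; have -> : (g * a)^-1 * (h * a) = (g^-1 * h) ^ a.
  by rewrite conjgE invMg !mulgA.
by rewrite -{1}(CJ a) memJ_conjg.
Qed.

(** [g * h^-1] is conjugate to [h^-1 * g], the inverse of [g^-1 * h]. *)
Lemma cayley_rel_inv (g h : gT) : cayley_rel C g^-1 h^-1 = cayley_rel C g h.
Proof.
rewrite -(cayley_rel_mulr h) -(cayley_rel_mull g) mulVg mulKVg mulg1.
exact: cayley_rel_sym.
Qed.

End NormalCayley.

Theorem theorem1p4 (gT : finGroupType) (C : {set gT})
    (C1 : 1%g \notin C) (CV : inverse_closed C) (CJ : conj_invariant C)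
    (Y : subgraph (cayley_graph C1 CV)) (coreY : is_core Y) :
  exists P : {set {set cayley_graph C1 CV}},
    partition P [set: cayley_graph C1 CV] /\
    forall V : {set cayley_graph C1 CV}, V \in P -> isomorphic (induced V) Y.
Proof.
have [[r hr] _] := coreY.
pose S : {set gT} := sub_vertices Y.
have hmul (a : gT) : @homomorphism (cayley_graph C1 CV) (cayley_graph C1 CV) (mulg a).
  by move=> g h; rewrite /= cayley_rel_mull.
pose t : gT := val (r 1).
(* [s a] is the element of [S] such that [a * s a] lies in the fibre of [t]. *)
have /all_sig2[s sS rs] (a : gT) : {s : gT | s \in S & val (r (a * s)) = t}.
  apply: sig2_eqW; have /setP/(_ t) := core_hom_onto coreY hr (hmul a).
  by rewrite (valP (r 1)) => /imsetP[x Sx tx]; exists x.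
pose c a := a * s a.
(* [r] is injective on [b * S], so [c b] is the only point of the fibre there. *)
have cE a b : (c a == c b) = (b^-1 * c a \in S).
  apply/eqP/idP=> [-> | Sb]; first by rewrite mulKg.
  rewrite -[LHS](mulKVg b); congr (b * _).
  by apply: (core_hom_inj coreY hr (hmul b)) => //; rewrite mulKVg !rs.
exists (preim_partition c [set: cayley_graph C1 CV]).
split=> [|_ /imsetP[a _ ->]]; first exact: preim_partitionP.
set V : {set cayley_graph C1 CV} := finset _.
have VE (b : gT) : (b \in V) = (b^-1 * c a \in S) by rewrite !inE cE.
have VS (x : induced V) : (val x : gT)^-1 * c a \in S.
  by rewrite -VE; apply: (valP x).
have SV (y : Y) : c a * (val y : gT)^-1 \in V.
  by rewrite VE invMg invgK mulgKV; apply: (valP y).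
exists (fun x => Sub ((val x : gT)^-1 * c a) (VS x)) => [|x y].
  exists (fun y => Sub (c a * (val y : gT)^-1) (SV y)) => x; apply: val_inj => /=.
    by rewrite invMg invgK mulKVg.
  by rewrite invMg invgK mulgKV.
rewrite /= /sub_rel /= (core_adj coreY (VS x) (VS y)) /induced_rel.
by rewrite (valP x) (valP y) /= cayley_rel_mulr ?cayley_rel_inv.
Qed.
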